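(* Let $\mathbb K$ be a non-Archimedean valued field with nontrivial valuation, let $X$ be a separable $F$-space over $\mathbb K$, and let $T\in L(X)$. The following statements are equivalent: (i) $T$ is supercyclic; (ii) for each pair of non-empty open sets $U,V\subset X$ there exist $n\in\mathbb N$ and $\lambda\in\mathbb K$ such that $\lambda T^n(U)\cap V\neq\varnothing$.
   Context: A non-Archimedean valued field is a commutative field $\mathbb K$ with a map $|\cdot|:\mathbb K\to[0,+\infty)$ such that $|\lambda|=0$ iff $\lambda=0$, $|\lambda\mu|=|\lambda||\mu|$, and $|\lambda+\mu|\le\max\{|\lambda|,|\mu|\}$; the valuation is always assumed nontrivial. An $F$-space is a topological vector space over $\mathbb K$ which is metrizable and complete. $L(X)$ denotes the set of all continuous linear operators from $X$ to $X$. $\mathbb N=\{1,2,3,\dots\}$ and $\mathbb Z_+=\{0,1,2,\dots\}$. An operator $T\in L(X)$ is supercyclic if there exists $\mathbf x\in X$ whose projective orbit $\{\lambda T^n(\mathbf x): n\in\mathbb Z_+,\ \lambda\in\mathbb K\}$ is dense in $X$.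
   Formalization: The case T = 0 on a nonzero X containing a dense line Kx is excluded: there (i) holds through n = 0 in the orbit but (ii) fails since n ≥ 1 (e.g. X = K = Q_p, T = 0), so the claim as printed is false exactly in that case. *)

(* Defs.v *)
From HB Require Import structures.
From mathcomp Require Import all_boot all_order all_algebra.
From mathcomp Require Import all_classical all_reals all_analysis.

Set Implicit Arguments.
Unset Strict Implicit.
Unset Printing Implicit Defensive.

Import Order.TTheory GRing.Theory Num.Theory.

Local Open Scope classical_set_scope.
Local Open Scope ring_scope.

HB.mixin Record Field_isNAValued (R : realType) K & GRing.Field K := {
  na_abs : K -> R ;
  na_abs_ge0 : forall x, 0 <= na_abs x ;
  na_abs_eq0 : forall x, na_abs x = 0 <-> x = 0 ;
  na_absM : forall x y, na_abs (x * y) = na_abs x * na_abs y ;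
  na_absD : forall x y, na_abs (x + y) <= Num.max (na_abs x) (na_abs y) ;
  na_abs_nontrivial : exists2 x, x != 0 & na_abs x != 1
}.

#[short(type="naValuedFieldType")]
HB.structure Definition NAValuedField (R : realType) :=
  {K of GRing.Field K & Field_isNAValued R K}.

Definition na_nbhs (R : realType) (K : naValuedFieldType R) (a : K) :
    set_system K :=
  filter_from [set e : R | 0 < e] (fun e => [set b | na_abs (b - a) < e]).

(* The topological modules of the library have scalars in a [numDomainType],
   which excludes non-Archimedean fields; moreover a class joining [Topological]
   and [GRing.Lmodule K] clashes with the library's [NbhsLmodule].  The vector
   space axioms are therefore repeated here, and the library's module structure
   is derived from them. *)
HB.mixin Record TopologicalZmodule_isNATvs (R : realType)
    (K : naValuedFieldType R) X & TopologicalZmodule X := {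
  na_scale : K -> X -> X ;
  na_scaleA : forall a b v, na_scale a (na_scale b v) = na_scale (a * b) v ;
  na_scale1 : left_id 1 na_scale ;
  na_scaleDr : right_distributive na_scale +%R ;
  na_scaleDl : forall v, {morph na_scale^~ v : a b / a + b} ;
  na_scale_continuous : forall (a : K) (x : X),
    (fun z : K * X => na_scale z.1 z.2) @ (na_nbhs a, nbhs x)
      --> nbhs (na_scale a x)
}.

#[short(type="naTvsType")]
HB.structure Definition NATvs (R : realType) (K : naValuedFieldType R) :=
  {X of TopologicalZmodule X & TopologicalZmodule_isNATvs R K X}.

HB.instance Definition _ (R : realType) (K : naValuedFieldType R)
    (X : naTvsType K) :=
  GRing.Zmodule_isLmodule.Build K X (@na_scaleA R K X) (@na_scale1 R K X)
    (@na_scaleDr R K X) (@na_scaleDl R K X).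

Definition metrizable (R : realType) (T : topologicalType) : Prop :=
  exists d : T -> T -> R,
    [/\ (forall x y, d x y = 0 <-> x = y),
        (forall x y, d x y = d y x),
        (forall x y z, d x z <= d x y + d y z) &
        (forall x, nbhs x =
           filter_from [set e : R | 0 < e] (fun e => [set y | d x y < e]))].

(* Completeness for the canonical uniformity of the additive group, whose
   entourages are the sets {(x, y) | x - y \in U}, U a neighbourhood of 0. *)
Definition tvs_cauchy (X : topologicalZmodType) (F : set_system X) : Prop :=
  forall U : set X, nbhs (0 : X) U -> \forall x & y \near F, U (x - y).

Definition tvs_complete (X : topologicalZmodType) : Prop :=
  forall F : set_system X, ProperFilter F -> tvs_cauchy F ->
    exists l : X, F --> l.

Definition F_space (R : realType) (K : naValuedFieldType R)
  (X : naTvsType K) : Prop := metrizable R X /\ tvs_complete X.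

Definition separable (T : topologicalType) : Prop :=
  exists2 S : set T, countable S & dense S.

Section Supercyclic.
Context (R : realType) (K : naValuedFieldType R) (X : naTvsType K).
Implicit Type T : X -> X.

Definition projective_orbit T (x : X) : set X :=
  [set y | exists (l : K) (n : nat), y = l *: iter n T x].

Definition supercyclic T : Prop := exists x : X, dense (projective_orbit T x).

Definition projectively_transitive T : Prop :=
  forall U V : set X, open U -> U !=set0 -> open V -> V !=set0 ->
    exists (n : nat) (l : K), (0 < n)%N /\
      ((fun x => l *: iter n T x) @` U) `&` V !=set0.

(* The zero operator on a nonzero space having a dense line (X of dimension 1,
   if K is complete).  Orbits start at n = 0 but transitivity asks for n >= 1,
   so such a T is supercyclic and not projectively transitive. *)
Definition zero_with_dense_line T : Prop :=
  (forall x, T x = 0) /\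
  exists2 x : X, x != 0 & dense (range (fun l : K => l *: x)).

End Supercyclic.

Lemma zero_with_dense_line_counterexample (R : realType) (K : naValuedFieldType R)
    (X : naTvsType K) (T : X -> X) : metrizable R X ->
  zero_with_dense_line T -> supercyclic T /\ ~ projectively_transitive T.
Proof.
move=> [d [d0 dC dT dE]] [T0 [x x0 dx]]; split.
  exists x => O O0 oO; have [y [Oy [l _ lE]]] := dx O O0 oO.
  by exists y; split=> //; exists l, 0%N.
have d_ge0 y z : 0 <= d y z.
  have := dT y z y; rewrite (dC z y) -mulr2n (proj2 (d0 y y) erefl).
  by rewrite pmulrn_lge0.
have oV : open [set y : X | y != 0].
  rewrite openE => y /= y0; rewrite /interior dE; exists (d y 0) => /=.
    by rewrite lt_def d_ge0 andbT; apply: contra y0 => /eqP/d0/eqP.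
  by move=> z /=; apply: contraTneq => ->; rewrite ltxx.
move=> /(_ setT _ openT (ex_intro _ x I) oV (ex_intro _ x x0)).
by move=> [[|n] [l [//= _ [z [[y _ <-]]]]]]; rewrite /= T0 scaler0 eqxx.
Qed.

(* Main.v *)
Require Import Defs.
From mathcomp Require Import all_boot all_order all_algebra.
From mathcomp Require Import all_classical all_reals all_analysis.

Set Implicit Arguments.
Unset Strict Implicit.
Unset Printing Implicit Defensive.

Import Order.TTheory GRing.Theory Num.Theory.

Local Open Scope classical_set_scope.
Local Open Scope ring_scope.

(** The implication from transitivity to supercyclicity is a Baire category
    argument.  For open U, the set of the x whose projective orbit meets U is
    open, and transitivity makes it dense when U is nonempty; a vector lying in
    all these sets, U ranging over a countable base, has a dense projective
    orbit ([transitive_supercyclic]).  Completeness of X is a property of its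
    additive group, and the given metric need be neither complete nor
    translation invariant, so the category theorem is proved with Cauchy
    filters of the group ([Baire_complete_group]).

    Conversely, let the projective orbit of x be dense.  If l T^m x lies in U
    with l <> 0, and k T^n x lies in V with n > m, then (k / l) T^(n-m) maps the
    first vector to the second.  Hence what is needed is that the multiples of
    T^n x with n > m still meet V, although finitely many lines have been
    removed from the orbit.  Over an incomplete K lines need not be closed, and
    even in an infinite-dimensional space over K a single line may be dense, so
    there are two cases.

    - If no line is dense, each line is nowhere dense, because the closure of a
      line is a subspace and a subspace with nonempty interior is everything
      ([line_somewhere_dense]).  Removing finitely many lines then leaves the
      orbit dense ([supercyclic_transitive_no_dense_line]).

    - If a line K y is dense, every nonzero vector spans a dense line
      ([line_dense_neq0]): X behaves like a line over the completion of K.  As T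
      is not the degenerate zero operator, T y <> 0, and n = 1 suffices for all
      U and V ([dense_line_transitive]). *)

(** * Metrizable spaces *)

Lemma metric_ge0 (R : realType) (T : Type) (d : T -> T -> R) :
  (forall x y, d x y = 0 <-> x = y) -> (forall x y, d x y = d y x) ->
  (forall x y z, d x z <= d x y + d y z) -> forall x y, 0 <= d x y.
Proof.
move=> d0 dC dT x y; have := dT x y x.
by rewrite (dC y x) -mulr2n (proj2 (d0 x x) erefl) pmulrn_lge0.
Qed.

Lemma metrizable_hausdorff (R : realType) (T : topologicalType) :
  metrizable R T -> hausdorff_space T.
Proof.
move=> [d [d0 dC dT dE]] x y xy; apply/d0/eqP.
rewrite eq_le (metric_ge0 d0 dC dT) andbT; apply/ler_addgt0Pr => e e0.
have e2 : 0 < e / 2 by rewrite divr_gt0.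
have [||z [xz yz]] := xy [set z | d x z < e / 2] [set z | d y z < e / 2].
- by rewrite dE; exists (e / 2).
- by rewrite dE; exists (e / 2).
rewrite add0r (le_trans (dT x z y))// (dC z) [leRHS]splitr.
by rewrite lerD// ltW.
Qed.

Lemma metrizable_regular (R : realType) (T : topologicalType) :
  metrizable R T -> regular_space T.
Proof.
move=> [d [d0 dC dT dE]] x N; rewrite {1}dE => -[e /= e0 eN].
have e2 : 0 < e / 2 by rewrite divr_gt0.
exists [set z | d x z < e / 2]; first by rewrite dE; exists (e / 2).
move=> z /(_ [set y | d z y < e / 2])[|y [xy zy]].
  by rewrite dE; exists (e / 2).
apply: eN => /=; rewrite (le_lt_trans (dT x y z))// (dC y) [ltRHS]splitr.
exact: ltrD.
Qed.

Lemma metrizable_separable_second_countable (R : realType)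
    (T : topologicalType) :
  metrizable R T -> separable T -> @second_countable T.
Proof.
move=> [d [d0 dC dT dE]] [S cS dS].
pose ball (p : T * nat) : set T := [set y | d p.1 y < p.2.+1%:R^-1].
exists [set interior (ball p) | p in S `*` setT].
  apply: card_le_trans (card_image_le _ _) _.
  exact: countableX cS (countableP _).
split=> [U [p _ <-]|x N]; first exact: open_interior.
rewrite {1}dE => -[e /= e0 eN].
have [n ne] : exists n, n.+1%:R^-1 < e / 2 :> R.
  have e2 : 0 < e / 2 by rewrite divr_gt0.
  have [n _ /(_ n (leqnn n)) nP] := near_infty_natSinv_lt (PosNum e2).
  by exists n.
have n2 : 0 < n.+1%:R^-1 / 2 :> R by rewrite divr_gt0.
have nx : nbhs x [set y | d x y < n.+1%:R^-1 / 2].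
  by rewrite dE; exists (n.+1%:R^-1 / 2).
have [||s [/interior_subset /= xs Ss]] :=
    dS (interior [set y | d x y < n.+1%:R^-1 / 2]).
- by exists x.
- exact: open_interior.
exists (interior (ball (s, n))).
  split; first by exists (s, n).
  rewrite /interior dE; exists (n.+1%:R^-1 / 2) => // y /= xy.
  rewrite /ball /= (le_lt_trans (dT s x y))// (dC s) [ltRHS]splitr.
  exact: ltrD.
move=> y /interior_subset /= sy; apply: eN => /=.
rewrite (le_lt_trans (dT x s y))// [ltRHS]splitr ltrD//.
  rewrite (lt_trans xs)// (le_lt_trans _ ne)// ler_pdivrMr//.
  by rewrite ler_peMr// ler1n.
exact: lt_trans ne.
Qed.

(** * The Baire category theorem for complete metrizable groups *)

(** The step of the category argument: closures keep the limit of the nested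
    sets inside them, and the smallness of V - V makes these sets Cauchy. *)
Lemma shrink_open (X : topologicalZmodType) (U W : set X) :
  regular_space X -> open U -> U !=set0 -> nbhs 0 W ->
  exists V : set X, [/\ open V, V !=set0, closure V `<=` U &
    forall p q, V p -> V q -> W (p - q)].
Proof.
move=> rX oU [x Ux] W0.
have [N Nx NU] : filter_from (nbhs x) closure U.
  by apply: rX; exact: open_nbhs_nbhs.
have [|[A B] /= [Ax Bx] AB] := @sub_continuous X (x, x) W; first by rewrite subrr.
have NABx : nbhs x (N `&` (A `&` B)) by do 2?apply: filterI.
exists (interior (N `&` (A `&` B))); split.
- exact: open_interior.
- by exists x.
- apply: subset_trans NU; apply: closure_subset.
  by move=> y /interior_subset[].
- move=> p q /interior_subset[_ [Ap _]] /interior_subset[_ [_ Bq]].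
  by have := AB (p, q); exact.
Qed.

(** The sets u_n are nested, with the closure of u_(n+1) inside u_n and G_n, and
    with differences in the n-th set of a countable base at 0.  The filter they
    generate is Cauchy, and its limit belongs to all of them. *)
Lemma Baire_complete_group (R : realType) (X : topologicalZmodType)
    (G : nat -> set X) : metrizable R X -> tvs_complete X ->
  (forall n, open (G n)) -> (forall n, dense (G n)) ->
  dense (\bigcap_n G n).
Proof.
move=> mX cX oG dG O O0 oO; have rX := metrizable_regular mX.
have [W [W0 WE]] : exists W : nat -> set X, (forall n, nbhs 0 (W n)) /\
    forall N, nbhs 0 N -> exists n, W n `<=` N.
  have [d [d0 dC dT dE]] := mX.
  exists (fun n => [set y | d 0 y < n.+1%:R^-1]); split=> [n|N].
    by rewrite dE; exists n.+1%:R^-1 => //=; rewrite invr_gt0.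
  rewrite dE => -[e /= e0 eN].
  have [n _ /(_ n (leqnn n))/= nP] := near_infty_natSinv_lt (PosNum e0).
  by exists n => y /= yn; apply: eN; exact: lt_trans nP.
pose E := {U : set X | open U /\ U !=set0}.
have step (p : nat * E) : exists U : E,
    closure (sval U) `<=` sval p.2 `&` G p.1 /\
    forall x y, sval U x -> sval U y -> W p.1 (x - y).
  case: p => n [U [oU U0]] /=.
  have [|||V [oV V0 VU VW]] := @shrink_open X (U `&` G n) (W n) rX.
  - exact: openI.
  - exact: dG.
  - exact: W0.
  by exists (exist _ V (conj oV V0)).
have [next nextP] := choice step.
pose u := fix u n : E := if n is m.+1 then next (m, u m)
                         else exist _ O (conj oO O0).
have uS n : closure (sval (u n.+1)) `<=` sval (u n) `&` G n.
  by have [] := nextP (n, u n).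
have uW n x y : sval (u n.+1) x -> sval (u n.+1) y -> W n (x - y).
  by have [_] := nextP (n, u n); apply.
have u_dec m n : (m <= n)%N -> sval (u n) `<=` sval (u m).
  move=> /subnKC <-; elim: (n - m)%N => [|k IH]; first by rewrite addn0.
  by rewrite addnS => x /subset_closure/uS[/IH].
pose F := filter_from [set: nat] (fun n => sval (u n)).
have FF : ProperFilter F.
  apply: filter_from_proper => [|n _]; last by case: (svalP (u n)).
  apply: filter_from_filter => [|m n _ _]; first by exists 0%N.
  exists (maxn m n) => // x ux.
  by split; apply: u_dec ux; rewrite ?leq_maxl ?leq_maxr.
have [l Fl] : exists l : X, F --> l.
  apply: cX => N /WE[n nN]; exists (sval (u n.+1), sval (u n.+1)) => /=.
    by split; exists n.+1.
  by move=> [x y] /= [ux uy]; exact/nN/uW.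
have lu n : (sval (u n) `&` G n) l.
  apply: uS => N /Fl[m _ mN].
  have [x ux] : sval (u (maxn n.+1 m)) !=set0 by case: (svalP (u (maxn n.+1 m))).
  exists x; split; first by apply: u_dec ux; exact: leq_maxl.
  by apply: mN; apply: u_dec ux; exact: leq_maxr.
exists l; split; first by have [] := lu 0%N.
by move=> n _; have [] := lu n.
Qed.

(** * Scalar multiplication *)

Lemma na_abs0 (R : realType) (K : naValuedFieldType R) : na_abs (0 : K) = 0.
Proof. exact/na_abs_eq0. Qed.

Lemma na_abs1 (R : realType) (K : naValuedFieldType R) : na_abs (1 : K) = 1.
Proof.
have a1 : na_abs (1 : K) != 0.
  by apply/eqP => /na_abs_eq0/eqP; rewrite oner_eq0.
by apply: (mulfI a1); rewrite -na_absM !mulr1.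
Qed.

Lemma na_absV (R : realType) (K : naValuedFieldType R) (x : K) :
  na_abs x^-1 = (na_abs x)^-1.
Proof.
have [->|x0] := eqVneq x 0.
  by rewrite invr0 na_abs0 invr0.
have ax : na_abs x != 0 by apply/eqP => /na_abs_eq0/eqP; rewrite (negPf x0).
by apply: (mulfI ax); rewrite -na_absM !divff// na_abs1.
Qed.

(** Nontriviality gives x with |x| different from 1, so x or its inverse has
    powers tending to 0. *)
Lemma na_abs_small (R : realType) (K : naValuedFieldType R) (e : R) :
  0 < e -> exists2 x : K, x != 0 & na_abs x < e.
Proof.
move=> e0.
have [x x0 x1] : exists2 x : K, x != 0 & na_abs x < 1.
  have [x x0 x1] := @na_abs_nontrivial R K.
  have [xl1|xg1|/eqP] := ltgtP (na_abs x) 1; last by rewrite (negPf x1).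
    by exists x.
  by exists x^-1; rewrite ?invr_eq0// na_absV invf_lt1// (lt_trans ltr01).
have aX n : na_abs (x ^+ n) = na_abs x ^+ n.
  by elim: n => [|n IH]; rewrite ?na_abs1// !exprS na_absM IH.
have /cvg_expr : `|na_abs x| < 1 by rewrite ger0_norm// na_abs_ge0.
move=> /cvgr0Pnorm_lt/(_ e e0)[n _ /(_ n (leqnn n)) /= nP].
by exists (x ^+ n); rewrite ?expf_neq0// aX (le_lt_trans (ler_norm _)).
Qed.

Section Scaling.
Context (R : realType) (K : naValuedFieldType R) (X : naTvsType K).
Implicit Types (x y z : X) (N U : set X).

(** Joint continuity of the scalar multiplication with explicit radii on the
    scalar side, where K carries no topological structure. *)
Lemma scale_near (a : K) x N : nbhs (a *: x) N ->
  exists e : R, [/\ 0 < e & exists2 M, nbhs x M &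
    forall b y, na_abs (b - a) < e -> M y -> N (b *: y)].
Proof.
move=> /(@na_scale_continuous R K X a x)[[A M] /= [[e /= e0 eA] Mx] AM].
exists e; split=> //; exists M => // b y be My.
by apply: (AM (b, y)); split=> //; exact: eA.
Qed.

Lemma scale_continuous (a : K) : continuous (fun x : X => a *: x).
Proof.
move=> x N /scale_near[e [e0 [M Mx MN]]]; apply: filterS Mx => y.
by apply: MN; rewrite subrr na_abs0.
Qed.

Lemma scale_absorb x y U : nbhs x U -> exists2 a : K, a != 0 & U (x + a *: y).
Proof.
move=> Ux.
have [|[A B] /= [Ax B0] AB] := @add_continuous X (x, 0) U; first by rewrite addr0.
have [|e [e0 [M My MB]]] := @scale_near 0 y B; first by rewrite scale0r.
have [a a0 ae] := na_abs_small K e0.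
exists a => //; apply: (AB (x, a *: y)); split=> /=; first exact: nbhs_singleton.
by apply: MB (nbhs_singleton My); rewrite subr0.
Qed.

Definition line x : set X := range (fun l : K => l *: x).

(** Around any p, write p = a^-1 ((u + a p) - u) with u in U and a so small that
    u + a p is in U; both u + a p and u are limits of points of the line, hence
    so is p. *)
Lemma line_somewhere_dense x U : open U -> U !=set0 ->
  (forall V, open V -> V !=set0 -> V `<=` U -> V `&` line x !=set0) ->
  dense (line x).
Proof.
move=> oU [u Uu] hU O [p Op] oO.
have [a a0 Ua] := @scale_absorb u p U (open_nbhs_nbhs (conj oU Uu)).
have : nbhs (a^-1 *: (u + a *: p - u)) O.
  by rewrite addrC addKr scalerA mulVf// scale1r; exact: open_nbhs_nbhs.
move=> /scale_continuous/(@sub_continuous X (u + a *: p, u))/=.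
move=> [[A B] /= [Aua Bu] AB].
have near_line v (N : set X) : nbhs v N -> U v -> exists l : K, N (l *: x).
  move=> Nv Uv.
  have [|||w [/interior_subset[Nw _] [l _ lE]]] := hU (interior (N `&` U)).
  - exact: open_interior.
  - by exists v; apply: filterI => //; exact: open_nbhs_nbhs.
  - by move=> y /interior_subset[].
  - by exists l; move: Nw; rewrite -lE.
have [l Al] := near_line _ _ Aua Ua; have [m Bm] := near_line _ _ Bu Uu.
exists ((a^-1 * (l - m)) *: x); split; last by exists (a^-1 * (l - m)).
by rewrite -scalerA scalerBl; exact: (AB (l *: x, m *: x)).
Qed.

(** If z is close to l x and z <> 0, then l cannot be close to 0, so l^-1 stays
    bounded and l^-1 z - x = l^-1 (z - l x) is small: x, which spans a dense
    line, is in the closure of the line of z. *)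
Lemma line_dense_neq0 x z : hausdorff_space X -> dense (line x) -> z != 0 ->
  dense (line z).
Proof.
move=> hX dx z0 O O0 oO.
have [w [Ow [l0 _ lE]]] := dx O O0 oO.
have : nbhs (l0 *: x) O by rewrite lE; exact: open_nbhs_nbhs.
move=> {w Ow lE} /scale_continuous; rewrite -(addr0 x).
move=> /(@add_continuous X (x, 0))[[A B] /= [Ax B0] AB].
have [|e [e0 [M M0 MB]]] := @scale_near 0 0 B; first by rewrite scale0r.
move: hX; rewrite open_hausdorff => /(_ z 0 z0)[[P Q] /= [Pz Q0]].
move=> [oP oQ /eqP PQ]; rewrite !inE in Pz Q0.
have [|e' [e'0 [L Lx LQ]]] := @scale_near 0 x Q.
  by rewrite scale0r; exact: open_nbhs_nbhs.
(* Scalars l with l x in P satisfy |l| >= e', as P misses Q.  The scalar c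
   turns the factor l^-1, of absolute value at most 1 / e', into the factor
   l^-1 c, of absolute value less than e, at the price of dividing z - l x by
   the constant c. *)
have [c c0 ce] := na_abs_small K (mulr_gt0 e0 e'0).
have : nbhs (c^-1 *: (z - z)) M by rewrite subrr scaler0.
move=> /scale_continuous/(@sub_continuous X (z, z))/=.
move=> [[A' B'] /= [A'z B'z] AB'].
have PBz : nbhs z (P `&` B').
  by apply: filterI => //; exact: open_nbhs_nbhs.
have [||w [/interior_subset[Pl Bl] [l _ lE]]] := dx (interior (P `&` B')).
- by exists z.
- exact: open_interior.
rewrite -lE in Pl Bl *.
have le : e' <= na_abs l.
  rewrite leNgt; apply/negP => le'.
  suff : (P `&` Q) (l *: x) by rewrite PQ.
  by split=> //; apply: LQ; [rewrite subr0|exact: nbhs_singleton].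
have l0' : l != 0.
  by apply: contraTneq le => ->; rewrite na_abs0 -ltNge.
exists (l0 *: (l^-1 *: z)); split; last by exists (l0 * l^-1); rewrite ?scalerA.
have -> : l^-1 *: z = x + (l^-1 * c) *: (c^-1 *: (z - l *: x)).
  rewrite scalerA -mulrA divff// mulr1 scalerBr scalerA mulVf// scale1r.
  by rewrite addrC subrK.
apply: (AB (x, _)); split; first exact: nbhs_singleton.
apply: MB; last by apply: (AB' (z, _)); split=> //=; exact: nbhs_singleton.
have al : 0 < na_abs l by exact: lt_le_trans le.
rewrite subr0 na_absM na_absV mulrC ltr_pdivrMr// (lt_le_trans ce)//.
by rewrite ler_wpM2l// ltW.
Qed.

End Scaling.

(** * Projective orbits *)

Section Orbits.
Context (R : realType) (K : naValuedFieldType R) (X : naTvsType K).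
Context (T : {linear X -> X}).

Lemma iter_linear n (l : K) (x : X) : iter n T (l *: x) = l *: iter n T x.
Proof. by elim: n => //= n ->; rewrite linearZ. Qed.

Lemma iter_continuous n : continuous (T : X -> X) -> continuous (iter n T).
Proof.
move=> cT; elim: n => [|n IH] x; first exact: cvg_id.
by apply: (@continuous_comp _ _ _ (iter n T) T); [exact: IH|exact: cT].
Qed.

(** Shrink U once for each line: by [line_somewhere_dense], a line that is not
    dense misses a nonempty open subset of any nonempty open set. *)
Lemma avoid_lines (y : nat -> X) (U : set X) m :
  (forall n, ~ dense (line (y n))) -> open U -> U !=set0 ->
  exists V : set X, [/\ open V, V !=set0, V `<=` U &
    forall n, (n < m)%N -> V `&` line (y n) = set0].
Proof.
move=> nd oU U0; elim: m => [|m [V [oV V0 VU Vm]]]; first by exists U; split=> // n; rewrite ltn0.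
have [W [oW W0 WV Wm]] : exists W : set X,
    [/\ open W, W !=set0, W `<=` V & W `&` line (y m) = set0].
  apply: contrapT => noW; apply: (nd m).
  apply: (@line_somewhere_dense _ _ _ (y m) V oV V0) => W oW W0 WV.
  by apply/set0P/eqP => WE; apply: noW; exists W.
exists W; split=> //; first exact: subset_trans VU.
move=> n; rewrite ltnS leq_eqVlt => /orP[/eqP->//|/Vm Vn].
by apply/seteqP; split=> x []; rewrite -Vn => /WV.
Qed.

Lemma supercyclic_transitive_no_dense_line :
  (forall y : X, ~ dense (line y)) -> supercyclic T ->
  projectively_transitive T.
Proof.
move=> nd [x dx] U V oU U0 oV V0.
(* Avoiding the line of 0, which is {0}, ensures that l is invertible. *)
have [U' [oU' U'0 U'U U'l]] := @avoid_lines (fun=> 0) U 1%N (fun=> nd 0) oU U0.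
have [w [U'y [l [m yE]]]] := dx U' U'0 oU'; rewrite {}yE in U'y.
have l0 : l != 0.
  apply/eqP => lE.
  suff : (U' `&` line (0 : X)) 0 by rewrite (U'l 0%N).
  by split; [move: U'y; rewrite lE scale0r|exists 0; rewrite ?scale0r].
have [V' [oV' V'0 V'V V'l]] :=
  @avoid_lines (fun n => iter n T x) V m.+1 (fun n => nd _) oV V0.
have [w' [V'y [k [n yE]]]] := dx V' V'0 oV'; rewrite {}yE in V'y.
have mn : (m < n)%N.
  rewrite ltnNge; apply/negP => nm.
  suff : (V' `&` line (iter n T x)) (k *: iter n T x) by rewrite V'l.
  by split=> //; exists k.
exists (n - m)%N, (k * l^-1); split; first by rewrite subn_gt0.
exists (k *: iter n T x); split; last exact: V'V.
exists (l *: iter m T x); first exact: U'U.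
by rewrite iter_linear -iterD subnK 1?ltnW// scalerA mulrAC -mulrA divff// mulr1.
Qed.

Lemma dense_line_transitive (y : X) :
  hausdorff_space X -> continuous (T : X -> X) -> ~ zero_with_dense_line T ->
  dense (line y) -> projectively_transitive T.
Proof.
move=> hX cT nz dy U V oU [u Uu] oV [v Vv].
have [y0|y0] := eqVneq y 0.
  have X0 (w : X) : w = 0.
    apply: contrapT => /eqP w0.
    have [A [oA wA A0]] := hausdorff_accessible hX w0.
    have [|w' [Ax [l _ lE]]] := dy A _ oA; first by exists w; exact: set_mem.
    by move/set_mem: A0; apply; move: Ax; rewrite -lE y0 scaler0.
  exists 1%N, 0; split=> //; exists v; split=> //.
  by exists u => //; rewrite [RHS]X0 [LHS]X0.
(* Otherwise T vanishes on a dense line, hence everywhere by continuity. *)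
have Ty0 : T y != 0.
  apply/eqP => Ty; apply: nz; split; last by exists y.
  move=> w; apply: contrapT => /eqP w0.
  have [A [oA /set_mem wA /set_mem A0]] := hausdorff_accessible hX w0.
  have [||w' [Ax [l _ lE]]] := dy (T @^-1` A).
  - by exists w.
  - by apply: open_comp => // z _; exact: cT.
  - by apply: A0; move: Ax; rewrite -lE /= linearZ /= Ty scaler0.
have dTy := line_dense_neq0 hX dy Ty0.
(* A multiple l y in U is needed with l invertible, so 0 is removed from U. *)
have y0U : (U `&` [set~ 0]) !=set0.
  have [a a0 Ua] := @scale_absorb _ _ _ u y U (open_nbhs_nbhs (conj oU Uu)).
  have [u0|u0] := eqVneq u 0; last by exists u; split=> //; exact/eqP.
  exists (u + a *: y); split=> //; rewrite u0 add0r; apply/eqP.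
  by rewrite scaler_eq0 negb_or a0.
have oU0 : open (U `&` [set~ 0 : X]).
  apply: openI => //; apply: closed_openC.
  exact/accessible_closed_set1/hausdorff_accessible.
have [w [[Ux x0] [l _ lE]]] := dy _ y0U oU0; rewrite -lE in Ux x0.
have l0 : l != 0 by apply/eqP => le; apply: x0; rewrite le scale0r.
have [|w' [Vx [k _ kE]]] := dTy V _ oV; first by exists v.
exists 1%N, (k * l^-1); split=> //; exists (k *: T y); split; last by rewrite kE.
exists (l *: y) => //=.
by rewrite linearZ /= scalerA -mulrA mulVf// mulr1.
Qed.

Lemma transitive_supercyclic : metrizable R X -> tvs_complete X ->
  separable X -> continuous (T : X -> X) ->
  projectively_transitive T -> supercyclic T.
Proof.
move=> mX cX sX cT tT.
have [B cB [oB nB]] := metrizable_separable_second_countable mX sX.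
pose hits (U : set X) : set X :=
  [set x | exists (l : K) (n : nat), U (l *: iter n T x)].
have oH U : open U -> open (hits U).
  move=> oU; have -> : hits U = \bigcup_(p in [set: K * nat])
      ((fun x : X => p.1 *: iter p.2 T x) @^-1` U).
    apply/seteqP; split=> [x [l [n lU]]|x [[l n] _ lU]]; first by exists (l, n).
    by exists l, n.
  apply: bigcup_open => -[l n] _; apply: open_comp => // x _.
  apply: (@continuous_comp _ _ _ (iter n T) (fun x : X => l *: x)).
    exact: iter_continuous.
  exact: scale_continuous.
have dH U : open U -> U !=set0 -> dense (hits U).
  move=> oU U0 O O0 oO; have [n [l [_ [_ [[x Ox <-] Ux]]]]] := tT O U oO O0 oU U0.
  by exists x; split=> //; exists l, n.
pose B' := B `&` [set U | U !=set0].
have [x Hx] : exists x, forall U, B' U -> hits U x.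
  have : countable B' by apply: sub_countable cB; apply: subset_card_le => U [].
  move=> /pfcard_geP[B'0|[g]]; first by exists 0 => U; rewrite B'0.
  have gB n : B' (g n) by exact: funS.
  have [||||x [_ Hx]] := @Baire_complete_group R X (hits \o g) mX cX _ _ setT.
  - by move=> n; apply: oH; apply: oB; case: (gB n).
  - by move=> n; apply: dH; [apply: oB; case: (gB n)|case: (gB n)].
  - by exists 0.
  - exact: openT.
  exists x => U /(@surj _ _ _ _ g)[n _ <-]; exact: Hx.
exists x => O [p Op] oO.
have [U [BU Up] UO] := nB p O (open_nbhs_nbhs (conj oO Op)).
have [|l [n Ul]] := Hx U; first by split=> //; exists p.
by exists (l *: iter n T x); split; [exact: UO|exists l, n].
Qed.

End Orbits.

Theorem theorem3p12 (R : realType) (K : naValuedFieldType R) (X : naTvsType K)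
    (X_F : F_space X) (X_sep : separable X)
    (T : {linear X -> X}) (T_cont : continuous (T : X -> X))
    (T_ndeg : ~ zero_with_dense_line T) :
  supercyclic T <-> projectively_transitive T.
Proof.
have [mX cX] := X_F; split; last exact: transitive_supercyclic.
move=> sT; have [[y dy]|nd] := pselect (exists y : X, dense (line y)).
  exact: (dense_line_transitive (metrizable_hausdorff mX) T_cont T_ndeg dy).
apply: supercyclic_transitive_no_dense_line sT => y dy.
by apply: nd; exists y.
Qed.
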